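(* Let $K\ge 2$, let $(p_{ij})_{i,j\in\Sigma}$ be the transition matrix of an irreducible, aperiodic Markov chain on $\Sigma=\{1,\dots,K\}$, and let $j\ge1$ be an integer. Then $$\lim_{m\to\infty}\frac{1}{\ln(m)}G_{m,j}=C_*\qquad\text{almost surely,}$$ where $C_*=\lim_{\theta\to-\infty}\frac{\rho(\theta)}{-\rho'(\theta)}$.
   Context: Boxes: they are indexed by words $u\in\bigcup_{n\ge0}\Sigma^n$. At generation $0$ there is one box $b_\emptyset$ of size $1$ and type $1$. A box $b_u$ of generation $n$ and type $i$ is split at generation $n+1$ into sub-boxes $b_{uk}$, $k\in\Sigma$, where $b_{uk}$ has type $k$ and size $|b_{uk}|=|b_u|\,p_{ik}$. Only boxes of strictly positive size (corresponding to possible trajectories) are considered. Balls: an infinite sequence of balls is thrown successively and independently; each ball starts in $b_\emptyset$ and, when in a box $b_u$, falls at the next generation into $b_{uk}$ with probability $|b_{uk}|/|b_u|$. $G_{m,j}$ is the first generation at which there exists a box containing strictly less than $j$ balls when the first $m$ balls have been thrown. For $\theta\in\mathbb R$, $A(\theta)=(p_{ij}^{\theta})_{i,j\in\Sigma}$ with the convention $p_{ij}^\theta=0$ if $p_{ij}=0$ (even for $\theta\le0$), and $\rho(\theta)$ is the maximum modulus (Perron–Frobenius) eigenvalue of $A(\theta)$; it is an analytic function of $\theta$ and $\ln\rho$ is convex. *)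

(* Defs.v *)
From HB Require Import structures.
From mathcomp Require Import all_boot all_order all_algebra.
From mathcomp Require Import complex.
From mathcomp Require Import all_classical all_reals all_analysis.

Set Implicit Arguments.
Unset Strict Implicit.
Unset Printing Implicit Defensive.

Import Order.TTheory GRing.Theory Num.Theory.
Import numFieldNormedType.Exports.

Local Open Scope classical_set_scope.
Local Open Scope ring_scope.

Section MarkovChain.
Context {R : realType} {K : nat}.
Implicit Types (p : 'M[R]_K).

Definition stochastic p : Prop :=
  (forall i j, 0 <= p i j) /\ (forall i, \sum_j p i j = 1).

Definition irreducible_chain p : Prop :=
  forall i j, exists n : nat, 0 < (p ^+ n) i j.

(* The gcd of the return times to i is 1: their only common divisor is 1. *)
Definition aperiodic_chain p : Prop :=
  forall (i : 'I_K) (d : nat),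
    (forall n : nat, (0 < n)%N -> 0 < (p ^+ n) i i -> (d %| n)%N) -> d = 1%N.

(* The test on p i j is needed at theta = 0, where 0 `^ 0 = 1. *)
Definition mx_powR p (theta : R) : 'M[R]_K :=
  \matrix_(i, j) (if p i j == 0 then 0 else p i j `^ theta).

(* The comparison of moduli takes place in R[i], whose norm is R[i]-valued. *)
Definition max_modulus_eigenvalue (A : 'M[R]_K) (r : R) : Prop :=
  eigenvalue A r /\
  forall z : R[i], eigenvalue (map_mx (real_complex R) A) z ->
    `|z| <= real_complex R r.

(* There is at most one such r; for p irreducible the Perron-Frobenius theorem
   says there is one, so the default value 0 is not reached. *)
Definition rho p (theta : R) : R :=
  xget 0 [set r | max_modulus_eigenvalue (mx_powR p theta) r].

Definition Cstar_ratio p (theta : R) : R :=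
  rho p theta / - derive1 (rho p) theta.

Definition Cstar p : R := lim (Cstar_ratio p theta @[theta --> -oo]).

End MarkovChain.

Section Boxes.
Context {R : realType} {K : nat}.
Variables (p : 'M[R]_K) (i0 : 'I_K).

(* The pair (type, size) of the box b_u, where i0 is the type of the box of
   generation 0. *)
Definition box (u : seq 'I_K) : 'I_K * R :=
  foldl (fun b k => (k, b.2 * p b.1 k)) (i0, 1) u.

Definition box_size (u : seq 'I_K) : R := (box u).2.

End Boxes.

(* X r l w is the last letter of the box of generation l.+1 that contains
   the ball number r. *)
Section Balls.
Context {R : realType} {K : nat} {d : measure_display} {T : measurableType d}.
Variables (p : 'M[R]_K) (i0 : 'I_K) (P : probability T R).
Variable X : nat -> nat -> T -> 'I_K.

Definition ball_box (r n : nat) (w : T) : seq 'I_K :=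
  mkseq (fun l => X r l w) n.

Definition ball_in (r : nat) (u : seq 'I_K) : set T :=
  [set w | ball_box r (size u) w = u].

Definition ball_sigma (r : nat) : set (set T) := <<s range (ball_in r) >>.

Definition balls_independent : Prop :=
  forall (I : seq nat) (E : nat -> set T), uniq I ->
    (forall r, r \in I -> ball_sigma r (E r)) ->
    P (\bigcap_(r in [set` I]) E r) = (\prod_(r <- I) P (E r))%E.

Record balls_process : Prop := BallsProcess {
  balls_measurable : forall r u, measurable (ball_in r u);
  (* the conditional probability of falling into b_{uk} from b_u, multiplied
     out *)
  balls_fall : forall r u k, 0 < box_size p i0 u ->
    P (ball_in r (rcons u k)) =
      (P (ball_in r u) *
       (box_size p i0 (rcons u k) / box_size p i0 u)%:E)%E;
  balls_indep : balls_independent }.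

Definition nb_balls (m : nat) (u : seq 'I_K) (w : T) : nat :=
  #|[pred r : 'I_m | ball_box r (size u) w == u]|.

Definition deficient_generation (m j : nat) (w : T) (n : nat) : Prop :=
  exists u : seq 'I_K,
    [/\ size u = n, 0 < box_size p i0 u & (nb_balls m u w < j)%N].

(* For 1 < K and p stochastic, irreducible and aperiodic, the number of boxes
   is unbounded as the generation grows, so a first deficient generation
   exists if 0 < j, and the default value 0 is not reached. *)
Definition first_deficient (m j : nat) (w : T) : nat :=
  xget 0%N [set n | deficient_generation m j w n /\
    forall n', deficient_generation m j w n' -> (n <= n')%N].

End Balls.

(* Main.v *)
(** Write A for mx_powR p theta, with Perron eigenvectors l, r > 0 normalised by
    l r = 1.  Pairing r at theta with the left eigenvector at theta + h gives
    rho' = l A' r, hence - rho' / rho is the mean of - ln p_ij under the edge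
    weights l_i A_ij r_j / rho, which form a circulation.  Since
    A_ij r_j <= rho r_i, at any theta' < 0 one has on every edge
    - ln p_ij <= ln rho(theta') / (- theta') + a potential difference, so
    - rho' / rho <= ln rho(theta') / (- theta'); Gibbs' inequality against p
    gives ln rho <= (1 - theta) (- rho' / rho).  So - rho' / rho tends to
    la := inf ln rho(theta) / (- theta) and Cstar = 1 / la.  The bound
    A_ij r_j <= rho r_i, which is an equality up to a factor K for some j,
    also shows, followed along a word, that the smallest positive box of
    generation n has size exp (- la n + o(n)).

    With m balls a box of size much larger than 1 / m is full and one of size
    much smaller than 1 / m is empty, so G_{m,j} ~ ln m / la; Borel-Cantelli
    over the generations makes this almost sure. *)

Require Import Defs.
From mathcomp Require Import all_boot all_order all_algebra.
From mathcomp Require Import complex ring lra.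
From mathcomp Require Import all_classical all_reals all_analysis.

Set Implicit Arguments.
Unset Strict Implicit.
Unset Printing Implicit Defensive.

Import Order.TTheory GRing.Theory Num.Theory.
Import numFieldNormedType.Exports.

Local Open Scope classical_set_scope.
Local Open Scope ring_scope.

(** * Continuity *)

Lemma cvg_closed_graph (U V : topologicalType) (T : Type) (F : set_system T)
    {FF : Filter F} (K : set U) (G : set (U * V)) (u0 : U) (v0 : V)
    (u : T -> U) (v : T -> V) :
  compact K -> closed G -> (forall x, K x -> G (x, v0) -> x = u0) ->
  v @ F --> v0 -> (\forall t \near F, K (u t) /\ G (u t, v t)) -> u @ F --> u0.
Proof.
move=> cK cG uniq_u0 vv0 KGu W; rewrite nbhsE => -[B [oB Bu0] BW].
have /compact_near_coveringP : compact (K `\` B).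
  by rewrite setDE; apply: compact_closedI => //; exact: open_closedC.
move=> /(_ _ F (fun t x => ~ G (x, v t)) FF) nG.
have {}nG : \forall t \near F, K `\` B `<=` (fun x => ~ G (x, v t)).
  apply: nG => x [Kx nBx].
  have : nbhs (x, v0) (~` G).
    apply: open_nbhs_nbhs; split; first exact: closed_openC.
    by move=> /(uniq_u0 _ Kx) xu0; apply: nBx; rewrite xu0.
  move=> [[C D] /= [xC v0D] CD]; exists (C, v @^-1` D).
    by split => //=; exact: vv0.
  by move=> [y t] [/= Cy Dt]; exact: (CD (y, v t)).
apply: filterS2 KGu nG => t [Ku Gu] nGt; apply: BW.
by apply: contrapT => nBu; exact: nGt (u t) _ Gu.
Qed.

Lemma cvg_mx (U : topologicalType) (T : Type) (F : set_system T)
    {FF : Filter F} m n (f : T -> 'M[U]_(m, n)) (M : 'M[U]_(m, n)) :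
  (forall i j, f t i j @[t --> F] --> M i j) -> f @ F --> M.
Proof.
move=> fM W [Q MQ QW].
have : \forall t \near F, forall ij : 'I_m * 'I_n, Q ij.1 ij.2 (f t ij.1 ij.2).
  apply: filter_forall => ij; apply: fM; exact: MQ.
by apply: filterS => t Qt; apply: QW => i j; exact: Qt (i, j).
Qed.

Section ContinuousMatrix.
Context {R : realType}.

Lemma cvg_mulmx (T : Type) (F : set_system T) {FF : Filter F} m n q
    (f : T -> 'M[R]_(m, n)) (g : T -> 'M[R]_(n, q)) (M : 'M[R]_(m, n))
    (N : 'M[R]_(n, q)) :
  f @ F --> M -> g @ F --> N -> f t *m g t @[t --> F] --> M *m N.
Proof.
move=> fM gN; apply: cvg_mx => i j; rewrite mxE.
under eq_cvg do rewrite mxE.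
apply: (@cvg_big R _ +%R 0 xpredT); first exact: add_continuous.
move=> k _; apply: cvgM.
  exact: (cvg_comp _ _ fM (@coord_continuous _ _ _ i k M)).
exact: (cvg_comp _ _ gN (@coord_continuous _ _ _ k j N)).
Qed.

End ContinuousMatrix.

(** * Perron eigenvectors *)

Lemma psumr_gt0 (R : numDomainType) (I : finType) (F : I -> R) k :
  (forall i, 0 <= F i) -> 0 < F k -> 0 < \sum_i F i.
Proof.
by move=> F0 Fk; rewrite (bigD1 k) //= ltr_pwDl // sumr_ge0.
Qed.

Section NonnegativeMatrix.
Context {R : numDomainType}.

Definition nonneg_mx m n (M : 'M[R]_(m, n)) : Prop := forall i j, 0 <= M i j.

Definition pos_mx m n (M : 'M[R]_(m, n)) : Prop := forall i j, 0 < M i j.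

Lemma pos_mx_nonneg m n (M : 'M[R]_(m, n)) : pos_mx M -> nonneg_mx M.
Proof. by move=> M0 i j; exact: ltW. Qed.

Lemma pos_const_mx m n (a : R) : 0 < a -> pos_mx (const_mx a : 'M[R]_(m, n)).
Proof. by move=> a0 i j; rewrite mxE. Qed.

Lemma nonneg_mulmx m n q (M : 'M[R]_(m, n)) (N : 'M[R]_(n, q)) :
  nonneg_mx M -> nonneg_mx N -> nonneg_mx (M *m N).
Proof.
by move=> M0 N0 i j; rewrite mxE sumr_ge0 // => k _; rewrite mulr_ge0.
Qed.

Lemma pos_mulmx_row n q (x : 'rV[R]_n) (M : 'M[R]_(n, q)) :
  nonneg_mx x -> x != 0 -> pos_mx M -> pos_mx (x *m M).
Proof.
move=> x0 /rV0Pn[k xk] M0 i j; rewrite mxE (ord1 i).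
apply: (@psumr_gt0 _ _ _ k) => [l|]; first by rewrite mulr_ge0 // ltW.
by rewrite mulr_gt0 // lt_def xk x0.
Qed.

Lemma pos_row_neq0 n (x : 'rV[R]_n) : (0 < n)%N -> pos_mx x -> x != 0.
Proof. by move=> n0 x0; apply/rV0Pn; exists (Ordinal n0); rewrite gt_eqF. Qed.

Lemma nonneg_mxX n (A : 'M[R]_n) k : nonneg_mx A -> nonneg_mx (A ^+ k).
Proof.
move=> A0; elim: k => [|k ih]; first by move=> i j; rewrite expr0 mxE ler0n.
by rewrite exprS -mulmxE; exact: nonneg_mulmx.
Qed.

End NonnegativeMatrix.

Lemma row_min_ratio (R : realFieldType) n (x y : 'rV[R]_n) :
  (0 < n)%N -> pos_mx y ->
  exists a, nonneg_mx (x - a *: y) /\ exists i, x ord0 i = a * y ord0 i.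
Proof.
move=> n0 y0; pose i := [arg min_(i < Ordinal n0) (x ord0 i / y ord0 i)]%O.
exists (x ord0 i / y ord0 i); split; last first.
  by exists i; rewrite divfK // gt_eqF.
move=> k j; rewrite (ord1 k) !mxE subr_ge0 -ler_pdivlMr // /i.
by case: arg_minP => // {}i _; exact.
Qed.

Section Simplex.
Context {R : numFieldType}.

Definition simplex n (r : 'cV[R]_n) : set 'rV[R]_n :=
  [set x | nonneg_mx x /\ x *m r = 1%:M].

Lemma simplex_scale n (r : 'cV[R]_n) (x : 'rV_n) : pos_mx r -> nonneg_mx x ->
  x != 0 -> exists2 a, 0 < a & simplex r (a *: x).
Proof.
move=> r0 x0 xn0; have := pos_mulmx_row x0 xn0 r0 ord0 ord0.
have := mx11_scalar (x *m r); move: (_ ord0 ord0) => c xr c0.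
exists c^-1; first by rewrite invr_gt0.
split; first by move=> i j; rewrite mxE mulr_ge0 // invr_ge0 ltW.
by rewrite -scalemxAl xr scale_scalar_mx mulVf // gt_eqF.
Qed.

Lemma simplex_sum n (r : 'cV[R]_n) x :
  simplex r x -> \sum_i x ord0 i * r i ord0 = 1.
Proof.
move=> [_ xr1]; have : (x *m r) ord0 ord0 = 1 by rewrite xr1 mxE eqxx.
by rewrite mxE.
Qed.

Lemma simplex_neq0 n (r : 'cV[R]_n) x : simplex r x -> x != 0.
Proof.
move=> /simplex_sum; apply: contra_eq_neq => ->.
by rewrite big1 1?eq_sym ?oner_eq0 // => i _; rewrite mxE mul0r.
Qed.

Lemma simplex_le n (r : 'cV[R]_n) x i : pos_mx r -> simplex r x ->
  x ord0 i <= (r i ord0)^-1.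
Proof.
move=> r0 xS; rewrite -[leRHS]mul1r ler_pdivlMr // -(simplex_sum xS).
rewrite (bigD1 i) //= lerDl sumr_ge0 // => j _.
by rewrite mulr_ge0 ?xS.1 // ltW.
Qed.

End Simplex.

Lemma trmx_exp (R : comNzRingType) n (A : 'M[R]_n) k : (A ^+ k)^T = A^T ^+ k.
Proof.
elim: k => [|k ih]; first by rewrite !expr0 trmx1.
by rewrite exprS -mulmxE trmx_mul ih mulmxE -exprSr.
Qed.

Lemma eigenvector_sum_exp (R : comNzRingType) n (A : 'M[R]_n) (x : 'rV[R]_n)
    t N :
  x *m A = t *: x ->
  x *m (\sum_(k < N) A ^+ k) = (\sum_(k < N) t ^+ k) *: x.
Proof.
move=> xA; rewrite mulmx_sumr scaler_suml; apply: eq_bigr => k _.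
elim: (k : nat) => [|m ih]; first by rewrite expr0 mulmx1 expr0 scale1r.
by rewrite exprSr -mulmxE mulmxA ih -scalemxAl xA scalerA exprSr.
Qed.

Section IrreducibleMatrix.
Context {R : realType}.

Lemma closed_nonneg_mx m n : closed [set M : 'M[R]_(m, n) | nonneg_mx M].
Proof.
have -> : [set M : 'M[R]_(m, n) | nonneg_mx M] =
    \bigcap_i \bigcap_j [set M : 'M[R]_(m, n) | 0 <= M i j].
  apply/seteqP; split => M h; first by move=> i _ j _; exact: h.
  by move=> i j; exact: h.
apply: closed_bigI => i _; apply: closed_bigI => j _.
by apply: preimage_closed (@closed_ge R 0) => M _; exact: coord_continuous.
Qed.

Lemma irreducible_sum_exp_pos n (A : 'M[R]_n) :
  nonneg_mx A -> irreducible_chain A -> exists N, pos_mx (\sum_(k < N) A ^+ k).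
Proof.
move=> A0 irrA; pose positive_entry ij k := 0 < (A ^+ k) ij.1 ij.2.
have /choice[k kP] ij : exists k, positive_entry ij k := irrA ij.1 ij.2.
exists (\max_ij k ij).+1 => i j.
have lt_k : (k (i, j) < (\max_ij k ij).+1)%N by rewrite ltnS leq_bigmax.
rewrite summxE; apply: (@psumr_gt0 _ _ _ (Ordinal lt_k)) => [m|].
  exact: nonneg_mxX.
exact: kP (i, j).
Qed.

Lemma irreducible_chain_support n (A B : 'M[R]_n) :
  nonneg_mx A -> nonneg_mx B ->
  (forall i j, 0 < A i j -> 0 < B i j) ->
  irreducible_chain A -> irreducible_chain B.
Proof.
move=> A0 B0 AB irrA i j; have [k Ak] := irrA i j; exists k.
elim: k i Ak => [|k ih] i; first by rewrite !expr0 !mxE.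
rewrite !exprS -!mulmxE !mxE => /lt0r_neq0/eqP AAk_neq0.
have [l _|l /andP[_]] := psumr_neq0P _ AAk_neq0.
  by apply: mulr_ge0 => //; exact: nonneg_mxX.
rewrite lt_def mulf_eq0 negb_or => /andP[/andP[Ail Alj] _].
apply: (@psumr_gt0 _ _ _ l) => [m|].
  by apply: mulr_ge0 => //; exact: nonneg_mxX.
apply: mulr_gt0; first by apply: AB; rewrite lt_def Ail A0.
by apply: ih; rewrite lt_def Alj; exact: nonneg_mxX.
Qed.

Lemma irreducible_chain_tr n (A : 'M[R]_n) :
  irreducible_chain A -> irreducible_chain A^T.
Proof.
by move=> irrA i j; have [k Ak] := irrA j i; exists k; rewrite -trmx_exp mxE.
Qed.

Lemma irreducible_eigenvector_pos n (A : 'M[R]_n) (x : 'rV[R]_n) t :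
  nonneg_mx A -> irreducible_chain A -> nonneg_mx x -> x != 0 ->
  x *m A = t *: x -> pos_mx x.
Proof.
move=> A0 irrA x0 xn0 xA i j; have [N SA0] := irreducible_sum_exp_pos A0 irrA.
have := pos_mulmx_row x0 xn0 SA0 i j; rewrite (eigenvector_sum_exp N xA) mxE.
by apply: contraTT; rewrite lt0r x0 andbT negbK => /eqP ->; rewrite mulr0 ltxx.
Qed.

(* For the smallest ratio [a] the vector [x - a l] has a zero entry, so
   it is not a positive eigenvector. *)
Lemma irreducible_eigenspace n (A : 'M[R]_n) (l x : 'rV[R]_n) t : (0 < n)%N ->
  nonneg_mx A -> irreducible_chain A -> pos_mx l -> l *m A = t *: l ->
  x *m A = t *: x -> exists a, x = a *: l.
Proof.
move=> n0 A0 irrA l0 lA xA; have [a [xal [i xi]]] := row_min_ratio x n0 l0.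
exists a; apply/eqP; rewrite -subr_eq0; apply: contraT => xal_neq0.
have xalA : (x - a *: l) *m A = t *: (x - a *: l).
  by rewrite mulmxBl -scalemxAl xA lA scalerBr !scalerA mulrC.
have := irreducible_eigenvector_pos A0 irrA xal xal_neq0 xalA ord0 i.
by rewrite !mxE xi subrr ltxx.
Qed.

Lemma compact_simplex n (r : 'cV[R]_n) : pos_mx r -> compact (simplex r).
Proof.
move=> r0; apply: (subclosed_compact _
  (@rV_compact R n (fun i => [set` `[0, (r i ord0)^-1]])
     (fun i => @segment_compact R _ _))).
  apply: closedI; first exact: closed_nonneg_mx.
  have mulr_cont : continuous (fun x : 'rV[R]_n => x *m r).
    move=> x; apply: (cvg_mulmx (F := nbhs x)); last exact: cvg_cst.
    exact: cvg_id.
  move/continuous_closedP: mulr_cont => /(_ [set 1%:M]); apply.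
  exact/accessible_closed_set1/hausdorff_accessible/norm_hausdorff.
by move=> x xS i /=; rewrite in_itv /= xS.1 simplex_le.
Qed.

Definition subinvariant n (A : 'M[R]_n) : set ('rV[R]_n * R) :=
  [set z | [/\ simplex (const_mx 1) z.1, 0 <= z.2 &
    nonneg_mx (z.1 *m A - z.2 *: z.1)]].

Lemma subinvariant_le n (A : 'M[R]_n) z : nonneg_mx A -> subinvariant A z ->
  z.2 <= \sum_j \sum_i A i j.
Proof.
move=> A0 [zS z0 zA]; rewrite -[leLHS]mulr1 -(simplex_sum zS) mulr_sumr.
apply: ler_sum => j _; have := zA ord0 j.
rewrite !mxE mulr1 subr_ge0 => /le_trans; apply; apply: ler_sum => i _.
rewrite ler_piMl //; have := simplex_le i (pos_const_mx ltr01) zS.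
by rewrite mxE invr1.
Qed.

Lemma compact_subinvariant n (A : 'M[R]_n) : nonneg_mx A ->
  compact (subinvariant A).
Proof.
move=> A0; pose M := \sum_j \sum_i A i j.
have -> : subinvariant A = (simplex (const_mx 1) `*` [set` `[0, M]]) `&`
    [set z | nonneg_mx (z.1 *m A - z.2 *: z.1)].
  apply/seteqP; split => [z zA|z [[zS /=]]].
    by case: (zA) => zS z0 zA0; do !split => //=;
      rewrite in_itv /= z0 subinvariant_le.
  by rewrite in_itv => /andP[z0 _] zA.
apply: compact_closedI.
  apply: compact_setX; last exact: segment_compact.
  exact/compact_simplex/pos_const_mx.
have gap_cont : continuous (fun z : 'rV[R]_n * R => z.1 *m A - z.2 *: z.1).
  move=> z; apply: (cvgB (F := nbhs z)).
    by apply: (cvg_mulmx (F := nbhs z)); [exact: cvg_fst|exact: cvg_cst].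
  by apply: (cvgZ (F := nbhs z)); [exact: cvg_snd|exact: cvg_fst].
by apply: preimage_closed (@closed_nonneg_mx _ _) => z _; exact: gap_cont.
Qed.

Lemma subinvariant_nonempty n (A : 'M[R]_n) : (0 < n)%N -> nonneg_mx A ->
  subinvariant A !=set0.
Proof.
move=> n0 A0; have ones0 : pos_mx (const_mx 1 : 'rV[R]_n).
  exact: pos_const_mx ltr01.
have [a a0 aS] := simplex_scale (pos_const_mx ltr01) (pos_mx_nonneg ones0)
  (pos_row_neq0 n0 ones0).
exists (a *: const_mx 1, 0); split => //=; rewrite scale0r subr0.
exact: nonneg_mulmx aS.1 A0.
Qed.

(* The positive matrix [\sum_(k < N) A ^+ k] commutes with [A] and makes the
   inequality [t *: x <= x *m A] strict in every entry. *)
Lemma subinvariant_improve n (A : 'M[R]_n) x t : (0 < n)%N -> nonneg_mx A ->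
  irreducible_chain A -> subinvariant A (x, t) -> x *m A != t *: x ->
  exists2 z, subinvariant A z & t < z.2.
Proof.
move=> n0 A0 irrA [xS t0 xA] xAn.
have [N SA0] := irreducible_sum_exp_pos A0 irrA.
set B := \sum_(k < N) A ^+ k in SA0.
have BA : B *m A = A *m B.
  by rewrite mulmx_suml mulmx_sumr; apply: eq_bigr => k _;
    rewrite mulmxE -exprS -exprSr.
have y0 : pos_mx (x *m B) := pos_mulmx_row xS.1 (simplex_neq0 xS) SA0.
have gapB : pos_mx ((x *m A - t *: x) *m B).
  by apply: pos_mulmx_row => //; rewrite subr_eq0.
have [e [gap_ge [i gap_i]]] := row_min_ratio ((x *m A - t *: x) *m B) n0 y0.
have e0 : 0 < e by have := gapB ord0 i; rewrite gap_i pmulr_lgt0.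
have [a a0 ayS] := simplex_scale (pos_const_mx ltr01) (pos_mx_nonneg y0)
  (pos_row_neq0 n0 y0).
exists (a *: (x *m B), t + e) => /=; last by rewrite ltrDl.
split => //=; first by rewrite addr_ge0 // ltW.
have -> : a *: (x *m B) *m A - (t + e) *: (a *: (x *m B)) =
    a *: ((x *m A - t *: x) *m B - e *: (x *m B)).
  rewrite mulmxBl -!scalemxAl -!mulmxA BA scalerDl opprD addrA.
  by rewrite !scalerBr !scalerA ![a * _]mulrC.
by move=> j k; rewrite mxE mulr_ge0 // ltW.
Qed.

Lemma irreducible_eigenvector n (A : 'M[R]_n) : (0 < n)%N -> nonneg_mx A ->
  irreducible_chain A -> exists t (x : 'rV[R]_n), pos_mx x /\ x *m A = t *: x.
Proof.
move=> n0 A0 irrA.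
have snd_cont : {within subinvariant A, continuous snd}.
  by apply: continuous_subspaceT => z; exact: cvg_snd.
have [[x t] /set_mem xt_sub t_max] := compact_EVT_max
  (subinvariant_nonempty n0 A0) (compact_subinvariant A0) snd_cont.
have [xS _ _] := xt_sub.
have xA : x *m A = t *: x.
  apply/eqP; apply: contraT => /(subinvariant_improve n0 A0 irrA xt_sub).
  by move=> [z /mem_set/t_max /le_lt_trans /[apply]]; rewrite ltxx.
exists t, x; split => //.
exact: irreducible_eigenvector_pos irrA xS.1 (simplex_neq0 xS) xA.
Qed.

End IrreducibleMatrix.

Section PerronPair.
Context {R : realType} {K : nat}.
Implicit Types (A : 'M[R]_K) (l x : 'rV[R]_K) (r : 'cV[R]_K).

Record perron A t l r : Prop := Perron {
  perron_left_gt0 : pos_mx l;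
  perron_right_gt0 : pos_mx r;
  perron_left : l *m A = t *: l;
  perron_right : A *m r = t *: r;
  perron_dot : l *m r = 1%:M }.

Lemma perron_left_coord A t l r j : perron A t l r ->
  \sum_i l ord0 i * A i j = t * l ord0 j.
Proof.
move=> /perron_left/(congr1 (fun x : 'rV_K => x ord0 j)).
by rewrite !mxE.
Qed.

Lemma perron_right_coord A t l r i : perron A t l r ->
  \sum_j A i j * r j ord0 = t * r i ord0.
Proof.
move=> /perron_right/(congr1 (fun x : 'cV_K => x i ord0)).
by rewrite !mxE.
Qed.

Lemma perron_exists A : (0 < K)%N -> nonneg_mx A -> irreducible_chain A ->
  exists t l r, perron A t l r.
Proof.
move=> K0 A0 irrA; have [t [x [x0 xA]]] := irreducible_eigenvector K0 A0 irrA.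
have AT0 : nonneg_mx A^T by move=> i j; rewrite mxE.
have [t' [y [y0 yA]]] :=
  irreducible_eigenvector K0 AT0 (irreducible_chain_tr irrA).
have yT0 : pos_mx y^T by move=> i j; rewrite mxE.
have Ay : A *m y^T = t' *: y^T.
  by apply: trmx_inj; rewrite trmx_mul linearZ /= trmxK.
have [a a0 [ax0 axy]] := simplex_scale yT0 (pos_mx_nonneg x0)
  (pos_row_neq0 K0 x0).
have axA : (a *: x) *m A = t *: (a *: x).
  by rewrite -scalemxAl xA !scalerA mulrC.
exists t, (a *: x), y^T; split => //; first by move=> i j; rewrite mxE mulr_gt0.
have : t *: 1%:M = t' *: 1%:M :> 'M[R]_1.
  by rewrite -{1}axy scalemxAl -axA -mulmxA Ay -scalemxAr axy.
by move=> /matrixP /(_ ord0 ord0); rewrite !mxE eqxx !mulr1 => ->.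
Qed.

Lemma perron_left_unique A t l r x : (0 < K)%N -> nonneg_mx A ->
  irreducible_chain A -> perron A t l r -> x *m A = t *: x -> x *m r = 1%:M ->
  x = l.
Proof.
move=> K0 A0 irrA [l0 _ lA _ lr] xA.
have [a ->] := irreducible_eigenspace K0 A0 irrA l0 lA xA.
rewrite -scalemxAl lr => /matrixP /(_ ord0 ord0).
by rewrite !mxE eqxx mulr1 => ->; rewrite scale1r.
Qed.

(* If [x *m r = 1] and [x *m A = t *: x] then [x *m A = x *m A *m r *m x], a
   condition that is closed in [(x, A)]. *)
Lemma cvg_perron_left (T : Type) (F : set_system T) {FF : Filter F} A t l r
    (A_ : T -> 'M[R]_K) (x_ : T -> 'rV[R]_K) (t_ : T -> R) : (0 < K)%N ->
  nonneg_mx A -> irreducible_chain A -> perron A t l r -> A_ @ F --> A ->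
  (forall h, simplex r (x_ h)) -> (forall h, x_ h *m A_ h = t_ h *: x_ h) ->
  x_ @ F --> l.
Proof.
move=> K0 A0 irrA lrA A_A x_S xA_.
pose gap (z : 'rV[R]_K * 'M[R]_K) := z.1 *m z.2 - z.1 *m z.2 *m r *m z.1.
have gap_cont : continuous gap.
  move=> z; have cvgA : z0.1 *m z0.2 @[z0 --> z] --> z.1 *m z.2.
    by apply: (cvg_mulmx (F := nbhs z)); [exact: cvg_fst|exact: cvg_snd].
  apply: (cvgB (F := nbhs z)) => //.
  apply: (cvg_mulmx (F := nbhs z)); last exact: cvg_fst.
  by apply: (cvg_mulmx (F := nbhs z)) => //; exact: cvg_cst.
have gap_closed : closed (gap @^-1` [set 0]).
  move/continuous_closedP: gap_cont; apply.
  exact/accessible_closed_set1/hausdorff_accessible/norm_hausdorff.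
apply: cvg_closed_graph (compact_simplex (perron_right_gt0 lrA)) gap_closed _
  A_A _.
  move=> x [_ xr] /eqP; rewrite /gap /= subr_eq0 -[x *m A *m r]mulmxA.
  rewrite (perron_right lrA) -scalemxAr xr -scalemxAl mul1mx => /eqP xA.
  exact: perron_left_unique lrA xA xr.
apply: nearW => h; split => //=; apply/eqP; rewrite subr_eq0 xA_.
by rewrite -!scalemxAl (x_S h).2 mul1mx.
Qed.

Lemma cvg_derive1 (V : normedModType R) (f : R -> V) a : derivable f a 1 ->
  h^-1 *: (f (h + a) - f a) @[h --> 0^'] --> derive1 f a.
Proof.
rewrite /derivable.
have -> : (fun h : R => h^-1 *: ((f \o shift a) (h *: 1) - f a)) =
    (fun h => h^-1 *: (f (h + a) - f a)).
  by apply/funext => h /=; rewrite [h *: 1]mulr1.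
by [].
Qed.

(* Pairing the right eigenvector at [theta] with left eigenvectors at nearby
   parameters turns increments of [t] into increments of [A_]. *)
Lemma derive1_perron (A_ : R -> 'M[R]_K) (t : R -> R) theta l r : (0 < K)%N ->
  nonneg_mx (A_ theta) -> irreducible_chain (A_ theta) ->
  (forall th, exists l' r', perron (A_ th) (t th) l' r') ->
  perron (A_ theta) (t theta) l r -> derivable A_ theta 1 ->
  derive1 t theta = (l *m derive1 A_ theta *m r) ord0 ord0.
Proof.
move=> K0 A0 irrA lrA_ lrA dA; have r0 := perron_right_gt0 lrA.
have /choice[x xP] h : exists x,
    simplex r x /\ x *m A_ (h + theta) = t (h + theta) *: x.
  have [l' [r' [l'0 _ l'A _ _]]] := lrA_ (h + theta).
  have [a _ aS] := simplex_scale r0 (pos_mx_nonneg l'0) (pos_row_neq0 K0 l'0).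
  by exists (a *: l'); rewrite -scalemxAl l'A !scalerA mulrC.
have A_cvg : (A_ \o shift theta) h @[h --> 0^'] --> A_ theta.
  apply/continuous_withinNshiftx/differentiable_continuous.
  exact/derivable1_diffP.
have x_cvg : x @ 0^' --> l.
  apply: (cvg_perron_left (t_ := t \o shift theta)) lrA A_cvg _ _ => //.
    by move=> h; have [] := xP h.
  by move=> h; have [] := xP h.
have quotientE h : h^-1 *: (t (h + theta) - t theta) =
    (x h *m (h^-1 *: (A_ (h + theta) - A_ theta)) *m r) ord0 ord0.
  rewrite -scalemxAr -scalemxAl mulmxBr mulmxBl (xP h).2 -mulmxA.
  rewrite (perron_right lrA) -scalemxAl -scalemxAr (xP h).1.2.
  by rewrite !mxE eqxx !mulr1.
apply: cvg_lim => //; under eq_cvg do rewrite quotientE.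
apply: (@cvg_comp _ _ _ _ (fun M : 'M[R]_1 => M ord0 ord0) _ _ _ _
  (@coord_continuous _ _ _ _ _ _)).
apply: cvg_mulmx; last exact: cvg_cst.
exact: cvg_mulmx x_cvg (cvg_derive1 dA).
Qed.

Let C := real_complex R.

Let real_complex_ge0 a : 0 <= a -> 0 <= C a.
Proof. by move=> a0; rewrite (_ : 0 = C 0) // lecR. Qed.

Lemma complex_eigenvalue_le A t r (z : R[i]) : nonneg_mx A -> pos_mx r ->
  A *m r = t *: r -> eigenvalue (map_mx C A) z -> `|z| <= C t.
Proof.
move=> A0 r0 Ar /eigenvalueP[v vA vn0].
have Cr0 i : 0 < C (r i ord0) by rewrite (_ : 0 = C 0) // ltcR.
have s0 : 0 < \sum_i `|v ord0 i| * C (r i ord0).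
  have /rV0Pn[k vk] := vn0; apply: (@psumr_gt0 _ _ _ k) => [i|].
    by rewrite mulr_ge0 // ltW.
  by rewrite mulr_gt0 // normr_gt0.
rewrite -(ler_pM2r s0) !mulr_sumr.
have -> : \sum_i C t * (`|v ord0 i| * C (r i ord0)) =
    \sum_j (\sum_i `|v ord0 i| * C (A i j)) * C (r j ord0).
  under [RHS]eq_bigr do rewrite mulr_suml.
  rewrite exchange_big /=; apply: eq_bigr => i _.
  under [RHS]eq_bigr do rewrite -mulrA -rmorphM.
  rewrite -mulr_sumr -rmorph_sum.
  have := congr1 (fun x : 'cV_K => x i ord0) Ar; rewrite !mxE => ->.
  by rewrite rmorphM mulrCA.
apply: ler_sum => j _; rewrite mulrA ler_wpM2r ?(ltW (Cr0 _)) //.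
have := congr1 (fun x : 'rV_K => x ord0 j) vA; rewrite !mxE -normrM => <-.
rewrite (le_trans (ler_norm_sum _ _ _)) // ler_sum // => i _.
by rewrite normrM mxE [X in _ * X]ger0_norm // real_complex_ge0.
Qed.

Lemma perron_max_modulus A t l r : (0 < K)%N -> nonneg_mx A -> perron A t l r ->
  max_modulus_eigenvalue A t.
Proof.
move=> K0 A0 [l0 r0 lA Ar _]; split => [|z]; last exact: complex_eigenvalue_le.
by apply/eigenvalueP; exists l; rewrite ?pos_row_neq0.
Qed.

Lemma max_modulus_eigenvalue_le A t t' : max_modulus_eigenvalue A t ->
  eigenvalue A t' -> t' <= t.
Proof.
move=> [_ t_max] /eigenvalueP[v vA vn0]; rewrite -lecR.
apply: le_trans (t_max (C t') _); last first.
  apply/eigenvalueP; exists (map_mx C v); last by rewrite map_mx_eq0.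
  by rewrite -map_mxM vA map_mxZ.
by rewrite normc_def /= expr0n /= addr0 sqrtr_sqr lecR ler_norm.
Qed.

Lemma rho_perron p theta t l r : (0 < K)%N -> nonneg_mx (mx_powR p theta) ->
  perron (mx_powR p theta) t l r -> rho p theta = t.
Proof.
move=> K0 A0 /(perron_max_modulus K0 A0) t_max; rewrite /rho.
case: xgetP => [t' _ t'_max|/(_ t) //]; apply/le_anti/andP; split.
  exact: max_modulus_eigenvalue_le t_max t'_max.1.
exact: max_modulus_eigenvalue_le t'_max t_max.1.
Qed.

End PerronPair.

(** * Stochastic matrices *)

Lemma iter_period (T : eqType) (f : T -> T) x n : (0 < n)%N -> iter n f x = x ->
  exists d, [/\ (0 < d)%N, iter d f x = x &
    forall m, iter m f x = x -> (d %| m)%N].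
Proof.
move=> n0 /eqP nx.
have ret : exists n, (0 < n)%N && (iter n f x == x) by exists n; rewrite n0.
case: (ex_minnP ret) => d /andP[d0 /eqP dx] d_min; exists d; split => // m mx.
have qdx q : iter (q * d) f x = x.
  by elim: q => // q ih; rewrite mulSn iterD ih.
have rx : iter (m %% d) f x = x.
  by rewrite -{2}mx {2}(divn_eq m d) addnC iterD qdx.
rewrite /dvdn; have [//|r0] := posnP (m %% d).
by have := d_min (m %% d)%N; rewrite r0 rx eqxx leqNgt ltn_mod d0 => /(_ isT).
Qed.

Section Stochastic.
Context {R : realType} {K : nat} (p : 'M[R]_K).
Hypothesis p_stoch : stochastic p.

Lemma stochastic_gt0 i j : p i j != 0 -> 0 < p i j.
Proof. by move=> pij; rewrite lt_def pij p_stoch.1. Qed.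

Lemma stochastic_le1 i j : p i j <= 1.
Proof.
rewrite -(p_stoch.2 i) (bigD1 j) //= lerDl.
by apply: sumr_ge0 => k _; exact: p_stoch.1.
Qed.

Lemma stochastic_next i : exists j, 0 < p i j.
Proof.
have sum_neq0 : \sum_j p i j <> 0 by rewrite p_stoch.2; exact/eqP/oner_neq0.
by have [j _|j] := psumr_neq0P _ sum_neq0; [exact: p_stoch.1|exists j].
Qed.

Lemma deterministic_chain : (forall i j, 0 < p i j -> p i j = 1) ->
  exists s : 'I_K -> 'I_K, forall n i j, (p ^+ n) i j = (j == iter n s i)%:R.
Proof.
move=> p01; have /choice[s sP] i : exists j, 0 < p i j := stochastic_next i.
exists s; have pE i j : p i j = (j == s i)%:R.
  have [->|jn] := eqVneq; first exact: p01.
  apply/eqP/negP => /negP/stochastic_gt0 pij; have := p_stoch.2 i.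
  rewrite (bigD1 j) //= (bigD1 (s i)) 1?eq_sym //=.
  rewrite (p01 _ _ pij) (p01 _ _ (sP i)) => /eqP.
  rewrite gt_eqF // ltrDl ltr_pwDl //.
  by apply: sumr_ge0 => k _; exact: p_stoch.1.
elim=> [|n ih] i j; first by rewrite expr0 mxE eq_sym.
rewrite exprS -mulmxE mxE (bigD1 (s i)) //= pE eqxx mul1r ih -iterSr.
by rewrite big1 ?addr0 // => k kn; rewrite pE (negbTE kn) mul0r.
Qed.

(* Otherwise the chain moves deterministically along a cycle through all the
   states, which is aperiodic only if it has length 1. *)
Lemma aperiodic_entry_lt1 : (1 < K)%N -> irreducible_chain p ->
  aperiodic_chain p -> exists i j, 0 < p i j < 1.
Proof.
move=> K2 p_irr p_aper; apply: contrapT => no_entry.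
have [i j pij|s pnE] := deterministic_chain.
  apply: contrapT => /eqP pij1; apply: no_entry; exists i, j.
  by rewrite pij lt_neqAle pij1 stochastic_le1.
have reach i j : exists n, iter n s i = j.
  by have [n] := p_irr i j; rewrite pnE ltr0n lt0b => /eqP; exists n.
pose i : 'I_K := Ordinal (ltnW K2).
have [n ni] := reach (s i) i.
have [//||d [_ di d_dvd]] := @iter_period _ s i n.+1; first by rewrite iterSr.
have d1 : d = 1%N.
  apply: (p_aper i) => m _; rewrite pnE ltr0n lt0b => /eqP mi.
  exact/d_dvd/esym.
have fix_i m : iter m s i = i by elim: m => //= m ->; move: di; rewrite d1.
by have [m] := reach i (Ordinal K2); rewrite fix_i => /(congr1 val).
Qed.

End Stochastic.

(** * Pressure *)

Section PowerMatrix.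
Context {R : realType} {K : nat} (p : 'M[R]_K).
Hypothesis p_stoch : stochastic p.
Implicit Types theta : R.
Local Notation A := (mx_powR p).

Lemma mx_powR_expR theta i j :
  0 < p i j -> A theta i j = expR (theta * ln (p i j)).
Proof. by move=> pij; rewrite mxE gt_eqF // /powR gt_eqF. Qed.

Lemma mx_powR_gt0 theta i j : 0 < p i j -> 0 < A theta i j.
Proof. by move=> pij; rewrite mx_powR_expR // expR_gt0. Qed.

Lemma mx_powR_nonneg theta : nonneg_mx (A theta).
Proof. by move=> i j; rewrite mxE; case: ifP => // _; exact: powR_ge0. Qed.

Lemma mx_powR_irreducible theta :
  irreducible_chain p -> irreducible_chain (A theta).
Proof.
apply: irreducible_chain_support; first exact: p_stoch.1.
- exact: mx_powR_nonneg.
- by move=> i j; exact: mx_powR_gt0.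
Qed.

Lemma le_mx_powR theta i j : theta <= 1 -> p i j <= A theta i j.
Proof.
move=> t1; have [p0|/(stochastic_gt0 p_stoch) pij] := eqVneq (p i j) 0.
  by rewrite mxE p0 eqxx.
rewrite mx_powR_expR // -[leLHS]lnK ?posrE // ler_expR -[leLHS]mul1r.
by rewrite ler_wnM2r // ln_le0 // stochastic_le1.
Qed.

Lemma lt_mx_powR theta i j : theta < 1 -> 0 < p i j < 1 -> p i j < A theta i j.
Proof.
move=> t1 /andP[pij pij1].
rewrite mx_powR_expR // -[ltLHS]lnK ?posrE // ltr_expR -[ltLHS]mul1r.
by rewrite ltr_nM2r // ln_lt0 // pij.
Qed.

Lemma is_derive_mx_powR theta i j :
  is_derive theta 1 (fun x : R => A x i j) (A theta i j * ln (p i j)).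
Proof.
have [p0|/(stochastic_gt0 p_stoch) pij] := eqVneq (p i j) 0.
  have -> : (fun x : R => A x i j) = cst 0.
    by apply/funext => x; rewrite mxE p0 eqxx.
  by rewrite mxE p0 eqxx mul0r; exact: is_derive_cst.
have -> : (fun x : R => A x i j) = expR \o (fun x : R => x * ln (p i j)).
  by apply/funext => x /=; rewrite mx_powR_expR.
rewrite mx_powR_expR //; apply: is_derive_eq.
by rewrite scaler0 add0r [_ *: 1]mulr1.
Qed.

Lemma derivable_mx_powR theta : derivable A theta 1.
Proof. by apply/derivable_mxP => i j; case: (is_derive_mx_powR theta i j). Qed.

Lemma derive1_mx_powR theta :
  derive1 A theta = \matrix_(i, j) (A theta i j * ln (p i j)).
Proof.
rewrite derive1E derive_mx; last exact: derivable_mx_powR.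
by apply/matrixP => i j; rewrite [LHS]mxE [RHS]mxE;
  case: (is_derive_mx_powR theta i j).
Qed.

End PowerMatrix.

Section PerronWeights.
Context {R : realType} {K : nat} (A : 'M[R]_K) (t : R) (l : 'rV[R]_K)
  (r : 'cV[R]_K).
Hypothesis lrA : perron A t l r.

Definition perron_weight i j : R := l ord0 i * A i j * r j ord0.

Lemma perron_weight_ge0 i j : 0 <= A i j -> 0 <= perron_weight i j.
Proof.
move=> Aij; rewrite !mulr_ge0 //; apply: ltW.
  exact: perron_left_gt0 lrA _ _.
exact: perron_right_gt0 lrA _ _.
Qed.

Lemma sum_perron_weight_row i :
  \sum_j perron_weight i j = t * (l ord0 i * r i ord0).
Proof.
rewrite mulrCA -(perron_right_coord i lrA) mulr_sumr.
by apply: eq_bigr => j _; rewrite mulrA.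
Qed.

Lemma sum_perron_weight_col j :
  \sum_i perron_weight i j = t * (l ord0 j * r j ord0).
Proof.
by rewrite mulrA -(perron_left_coord j lrA) mulr_suml.
Qed.

Lemma sum_perron_dot : \sum_i l ord0 i * r i ord0 = 1.
Proof.
by apply: simplex_sum; split; [exact/pos_mx_nonneg/perron_left_gt0/lrA|
  exact: perron_dot lrA].
Qed.

(* The weights form a circulation, on which a potential difference sums to
   0. *)
Lemma sum_perron_weight_potential c (g : 'I_K -> R) :
  \sum_i \sum_j perron_weight i j * (c + g i - g j) = t * c.
Proof.
transitivity (\sum_i \sum_j perron_weight i j * (c + g i) -
              \sum_i \sum_j perron_weight i j * g j).
  rewrite -sumrB; apply: eq_bigr => i _; rewrite -sumrB.
  by apply: eq_bigr => j _; rewrite mulrBr.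
rewrite [X in _ - X]exchange_big /= -sumrB.
rewrite -[RHS]mulr1 -sum_perron_dot mulr_sumr; apply: eq_bigr => i _.
rewrite -mulr_suml sum_perron_weight_row.
rewrite -(mulr_suml _ _ (perron_weight^~ i)) sum_perron_weight_col; ring.
Qed.

Lemma perron_edge_le i j : nonneg_mx A -> A i j * r j ord0 <= t * r i ord0.
Proof.
move=> A0; rewrite -(perron_right_coord i lrA) (bigD1 j) //= lerDl.
by apply: sumr_ge0 => k _; rewrite mulr_ge0 // ltW // (perron_right_gt0 lrA).
Qed.

Lemma perron_edge_ge i : exists j, t * r i ord0 <= K%:R * (A i j * r j ord0).
Proof.
have [j _ j_max] := @arg_maxP _ _ _ i predT (fun j => A i j * r j ord0) isT.
exists j; rewrite -(perron_right_coord i lrA).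
have -> : K%:R * (A i j * r j ord0) =
    \sum_(k < K) A i j * r j ord0 by rewrite sumr_const card_ord mulr_natl.
by apply: ler_sum => k _; exact: j_max.
Qed.

Lemma perron_gt1 i : (forall k, 1 <= \sum_j A k j) -> 1 < \sum_j A i j -> 1 < t.
Proof.
move=> rows_ge1 row_gt1; have l0 := perron_left_gt0 lrA.
have s0 : 0 < \sum_k l ord0 k.
  by apply: (@psumr_gt0 _ _ _ i) => // k; exact: ltW.
rewrite -(ltr_pM2r s0) mul1r mulr_sumr.
have -> : \sum_j t * l ord0 j = \sum_k l ord0 k * \sum_j A k j.
  under [RHS]eq_bigr do rewrite mulr_sumr.
  rewrite exchange_big; apply: eq_bigr => j _.
  by rewrite (perron_left_coord j lrA).
rewrite (bigD1 i) //= [ltRHS](bigD1 i) //= ltr_leD //.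
  by rewrite ltr_pMr.
by apply: ler_sum => k _; rewrite ler_peMr // ltW.
Qed.

End PerronWeights.

Lemma gibbs_le (R : realType) (a b : R) : 0 < a -> 0 < b ->
  a * (ln b - ln a) <= b - a.
Proof.
move=> a0 b0; rewrite -ln_div ?posrE // -ler_pdivlMl // mulrBr mulVf ?gt_eqF //.
rewrite [a^-1 * b]mulrC; have := @le_ln1Dx _ (b / a - 1).
by rewrite subrKC; apply; rewrite ltrBrDl subrr divr_gt0.
Qed.

Section Pressure.
Context {R : realType} {K : nat} (p : 'M[R]_K).
Hypotheses (K0 : (0 < K)%N) (p_stoch : stochastic p)
  (p_irr : irreducible_chain p).
Implicit Types theta : R.
Local Notation A := (mx_powR p).

Definition pressure theta : R := ln (rho p theta).

Definition pressure_decay theta : R := - derive1 (rho p) theta / rho p theta.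

Lemma perron_mx_powR theta : exists l r, perron (A theta) (rho p theta) l r.
Proof.
have A0 := mx_powR_nonneg p theta.
have irrA := mx_powR_irreducible p_stoch theta p_irr.
have [t [l [r lrA]]] := perron_exists K0 A0 irrA.
by exists l, r; rewrite (rho_perron K0 A0 lrA).
Qed.

Lemma rho_gt0 theta : 0 < rho p theta.
Proof.
have [l [r lrA]] := perron_mx_powR theta; pose i := Ordinal K0.
have r0 := perron_right_gt0 lrA; have [j pij] := stochastic_next p_stoch i.
rewrite -(pmulr_lgt0 _ (r0 i ord0)).
apply: lt_le_trans (perron_edge_le lrA i j (mx_powR_nonneg p _)).
by rewrite mulr_gt0 // mx_powR_gt0.
Qed.

Lemma derive1_rho theta l r : perron (A theta) (rho p theta) l r ->
  - derive1 (rho p) theta =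
  \sum_i \sum_j perron_weight (A theta) l r i j * - ln (p i j).
Proof.
move=> lrA; rewrite (derive1_perron K0 _ _ perron_mx_powR lrA).
- rewrite derive1_mx_powR // mxE -sumrN exchange_big /=; apply: eq_bigr => j _.
  rewrite mxE mulr_suml -sumrN; apply: eq_bigr => i _.
  by rewrite mxE /perron_weight; ring.
- exact: mx_powR_nonneg.
- exact: mx_powR_irreducible.
- exact: derivable_mx_powR.
Qed.

Lemma pressure_edge_le theta l r i j : perron (A theta) (rho p theta) l r ->
  0 < p i j ->
  theta * ln (p i j) + ln (r j ord0) <= pressure theta + ln (r i ord0).
Proof.
move=> lrA pij; have r0 := perron_right_gt0 lrA; have t0 := rho_gt0 theta.
rewrite -(expRK (theta * _)) -mx_powR_expR // -!lnM ?posrE ?mx_powR_gt0 //.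
rewrite ler_ln ?posrE ?mulr_gt0 ?mx_powR_gt0 //.
exact: (perron_edge_le lrA i j (mx_powR_nonneg p _)).
Qed.

Lemma pressure_edge_ge theta l r i : perron (A theta) (rho p theta) l r ->
  exists2 j, 0 < p i j & pressure theta - ln K%:R + ln (r i ord0) <=
    theta * ln (p i j) + ln (r j ord0).
Proof.
move=> lrA; have r0 := perron_right_gt0 lrA; have t0 := rho_gt0 theta.
have K0R : (0 : R) < K%:R by rewrite ltr0n.
have [j edge_ge] := perron_edge_ge lrA i.
have pij : 0 < p i j.
  apply: stochastic_gt0 => //; apply: contraTneq edge_ge => p0.
  by rewrite mxE p0 eqxx mul0r mulr0 -ltNge mulr_gt0.
exists j => //; move: edge_ge; have Aij := mx_powR_gt0 theta pij.
rewrite -ler_ln ?posrE ?mulr_gt0 // !lnM ?posrE ?mulr_gt0 // mx_powR_expR //.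
by rewrite expRK /pressure; lra.
Qed.

(* The bound [pressure_edge_le] at [theta'] is averaged over the weights at
   [theta]. *)
Lemma pressure_decay_le theta theta' : theta' <= 0 ->
  pressure_decay theta * - theta' <= pressure theta'.
Proof.
move=> t'0; have [l [r lrA]] := perron_mx_powR theta.
have [l' [r' lrA']] := perron_mx_powR theta'.
rewrite mulrAC ler_pdivrMr ?rho_gt0 // [leRHS]mulrC (derive1_rho lrA).
rewrite -(sum_perron_weight_potential lrA _ (fun i => ln (r' i ord0))).
rewrite mulr_suml; apply: ler_sum => i _; rewrite mulr_suml.
apply: ler_sum => j _; rewrite -[leLHS]mulrA.
have [p0|/(stochastic_gt0 p_stoch) pij] := eqVneq (p i j) 0.
  by rewrite /perron_weight mxE p0 eqxx mulr0 !mul0r.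
rewrite ler_wpM2l //.
  by apply: (perron_weight_ge0 lrA); exact: mx_powR_nonneg.
by rewrite mulrNN mulrC lerBrDr; exact: pressure_edge_le lrA' pij.
Qed.

(* Gibbs' inequality for the transition matrix [A_ij r_j / (rho r_i)] against
   [p]. *)
Lemma pressure_le_decay theta :
  pressure theta <= pressure_decay theta * (1 - theta).
Proof.
have [l [r lrA]] := perron_mx_powR theta; have t0 := rho_gt0 theta.
have [l0 r0 _ _ _] := lrA.
rewrite mulrAC ler_pdivlMr // mulrC (derive1_rho lrA) -subr_le0.
rewrite -(sum_perron_weight_potential lrA _ (fun i => ln (r i ord0))).
rewrite mulr_suml -sumrB; set w := perron_weight (A theta) l r.
pose v i j := rho p theta * (l ord0 i * r i ord0) * p i j.
apply: (@le_trans _ _ (\sum_i \sum_j (v i j - w i j))); last first.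
  rewrite big1 // => i _; rewrite sumrB -mulr_sumr p_stoch.2 mulr1.
  by rewrite (sum_perron_weight_row lrA) subrr.
apply: ler_sum => i _; rewrite mulr_suml -sumrB; apply: ler_sum => j _.
have [p0|/(stochastic_gt0 p_stoch) pij] := eqVneq (p i j) 0.
  by rewrite /v /w /perron_weight mxE p0 eqxx !(mulr0, mul0r, subr0).
have Aij := mx_powR_gt0 theta pij.
have w0 : 0 < w i j by rewrite !mulr_gt0.
have v0 : 0 < v i j by rewrite !mulr_gt0.
have ln_ratio : ln (v i j) - ln (w i j) = pressure theta + ln (r i ord0) -
    ln (r j ord0) - (1 - theta) * - ln (p i j).
  rewrite /v /w /perron_weight !lnM ?posrE ?mulr_gt0 //.
  by rewrite (mx_powR_expR theta pij) expRK /pressure; ring.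
have := gibbs_le w0 v0; rewrite ln_ratio; lra.
Qed.

End Pressure.

Section DecayRate.
Context {R : realType} {K : nat} (p : 'M[R]_K).
Hypotheses (K2 : (1 < K)%N) (p_stoch : stochastic p)
  (p_irr : irreducible_chain p) (p_aper : aperiodic_chain p).
Let K0 : (0 < K)%N := ltnW K2.
Implicit Types theta : R.

Lemma rho_gt1 theta : theta < 1 -> 1 < rho p theta.
Proof.
move=> t1; have [l [r lrA]] := perron_mx_powR K0 p_stoch p_irr theta.
have [i [j pij]] := aperiodic_entry_lt1 p_stoch K2 p_irr p_aper.
apply: (perron_gt1 (i := i) lrA) => [k|].
  by rewrite -(p_stoch.2 k); apply: ler_sum => m _; rewrite le_mx_powR // ltW.
rewrite -(p_stoch.2 i) (bigD1 j) //= [ltRHS](bigD1 j) //= ltr_leD //.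
  exact: lt_mx_powR.
by apply: ler_sum => m _; rewrite le_mx_powR // ltW.
Qed.

Definition decay_rate : R :=
  inf [set pressure p theta / - theta | theta in [set theta | theta < 0]].

Let decay_rate_has_inf :
  has_inf [set pressure p theta / - theta | theta in [set theta | theta < 0]].
Proof.
split.
  by exists (pressure p (-1) / - -1); exists (-1) => //=; rewrite ltrN10.
exists (pressure_decay p 0) => _ [theta /= t0 <-].
by rewrite ler_pdivlMr ?oppr_gt0 // pressure_decay_le // ltW.
Qed.

Lemma pressure_decay_le_rate theta : pressure_decay p theta <= decay_rate.
Proof.
apply: lb_le_inf; first exact: decay_rate_has_inf.1.
move=> _ [theta' /= t'0 <-].
by rewrite ler_pdivlMr ?oppr_gt0 // pressure_decay_le // ltW.
Qed.

Lemma rate_le_pressure theta : theta < 0 ->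
  decay_rate * - theta <= pressure p theta.
Proof.
move=> t0; rewrite -ler_pdivlMr ?oppr_gt0 //.
by apply: ge_inf; [exact: decay_rate_has_inf.2|exists theta].
Qed.

Lemma pressure_le_rate theta : theta < 0 ->
  pressure p theta <= decay_rate * (1 - theta).
Proof.
move=> t0; apply: le_trans (pressure_le_decay K0 p_stoch p_irr theta) _.
by rewrite ler_wpM2r ?pressure_decay_le_rate // subr_ge0 ltW // (lt_trans t0).
Qed.

Lemma decay_rate_gt0 : 0 < decay_rate.
Proof.
have := pressure_le_rate (ltrN10 R).
have := ln_gt0 (rho_gt1 (lt_trans (ltrN10 R) ltr01)).
rewrite /pressure; lra.
Qed.

Lemma Cstar_ratioE theta : Cstar_ratio p theta = (pressure_decay p theta)^-1.
Proof. by rewrite /Cstar_ratio /pressure_decay invf_div. Qed.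

Lemma pressure_decay_cvg :
  pressure_decay p theta @[theta --> -oo] --> decay_rate.
Proof.
apply/cvgrPdist_le => e e0; near=> theta.
have t0 : theta < 0 by near: theta; exact: nbhs_ninfty_lt.
have te : theta <= 1 - decay_rate / e.
  by near: theta; apply: nbhs_ninfty_le; exact: num_real.
have t1 : 0 < 1 - theta by rewrite subr_gt0 (lt_trans t0).
rewrite ger0_norm ?subr_ge0 ?pressure_decay_le_rate // lerBlDr -lerBlDl.
rewrite -(ler_pM2r t1).
apply: le_trans (pressure_le_decay K0 p_stoch p_irr theta).
apply: le_trans (rate_le_pressure t0).
have : decay_rate <= (1 - theta) * e.
  by rewrite -ler_pdivrMr // lerBrDl -lerBrDr.
lra.
Unshelve. all: by end_near. Qed.

Lemma Cstar_ratio_cvg : Cstar_ratio p theta @[theta --> -oo] --> decay_rate^-1.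
Proof.
under eq_cvg do rewrite Cstar_ratioE.
by apply: cvgV pressure_decay_cvg; rewrite gt_eqF // decay_rate_gt0.
Qed.

End DecayRate.

(** * Sizes of the boxes *)

Section BoxSizes.
Context {R : realType} {K : nat} (p : 'M[R]_K) (i0 : 'I_K).
Hypothesis p_stoch : stochastic p.
Local Notation q := (box_size p i0).
Local Notation type u := (box p i0 u).1.

Lemma box_rcons u k : box p i0 (rcons u k) = (k, q u * p (type u) k).
Proof. by rewrite /box_size /box foldl_rcons. Qed.

Lemma box_size_rcons u k : q (rcons u k) = q u * p (type u) k.
Proof. by rewrite {1}/box_size box_rcons. Qed.

Lemma box_size_ge0 u : 0 <= q u.
Proof.
elim/last_ind: u => [|u k ih]; first exact: ler01.
by rewrite box_size_rcons mulr_ge0 // p_stoch.1.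
Qed.

Lemma box_size_le1 u : q u <= 1.
Proof.
elim/last_ind: u => [|u k ih]; first exact: lexx.
by rewrite box_size_rcons mulr_ile1 ?box_size_ge0 ?p_stoch.1 ?stochastic_le1.
Qed.

Lemma box_size_rcons_gt0 u k : 0 < q (rcons u k) -> 0 < q u /\ 0 < p (type u) k.
Proof.
rewrite box_size_rcons lt0r mulf_eq0 negb_or => /andP[/andP[un0 pn0] _].
by rewrite !lt_def un0 pn0 box_size_ge0 p_stoch.1.
Qed.

Lemma box_size_gt0_next u : 0 < q u -> exists k, 0 < q (rcons u k).
Proof.
move=> u0; have [k pk] := stochastic_next p_stoch (type u).
by exists k; rewrite box_size_rcons mulr_gt0.
Qed.

(* Box sizes are at most 1 and every generation has a box of positive size, so
   the neutral element 1 does not affect the minimum. *)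
Definition min_box_size n : R :=
  \big[Num.min/1]_(u : n.-tuple 'I_K | 0 < q u) q u.

Lemma min_box_size_le u : 0 < q u -> min_box_size (size u) <= q u.
Proof. exact: (@bigmin_le_cond _ _ _ 1 (in_tuple u)). Qed.

Lemma min_box_size_attained n :
  exists u, [/\ size u = n, 0 < q u & q u = min_box_size n].
Proof.
have [u [un u0]] : exists u, size u = n /\ 0 < q u.
  elim: n => [|n [u [<- /box_size_gt0_next[k uk0]]]].
    by exists [::]; rewrite ltr01.
  by exists (rcons u k); rewrite size_rcons.
have {}un : size u == n by apply/eqP.
have [v v0 minE] := eq_bigmin (x := 1) (Tuple un)
  (fun v : n.-tuple 'I_K => 0 < q v) (fun v => q v) u0
  (fun v _ => box_size_le1 v).
by exists v; split; [exact: size_tuple|exact: v0|exact: esym minE].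
Qed.

Section PressureBounds.
Hypotheses (K0 : (0 < K)%N) (p_irr : irreducible_chain p).
Variables (theta : R) (l : 'rV[R]_K) (r : 'cV[R]_K).
Hypothesis lrA : perron (mx_powR p theta) (rho p theta) l r.

Lemma ln_box_size_le u : 0 < q u ->
  theta * ln (q u) + ln (r (type u) ord0) <=
  (size u)%:R * pressure p theta + ln (r i0 ord0).
Proof.
elim/last_ind: u => [|u k ih]; first by rewrite ln1 mulr0 mul0r.
move=> /box_size_rcons_gt0[u0 pk]; rewrite box_size_rcons box_rcons /=.
rewrite lnM ?posrE // size_rcons -natr1.
have := ih u0; have := pressure_edge_le K0 p_stoch p_irr lrA pk; lra.
Qed.

Lemma ln_box_size_ge n : exists u, [/\ size u = n, 0 < q u &
  n%:R * (pressure p theta - ln K%:R) + ln (r i0 ord0) <=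
  theta * ln (q u) + ln (r (type u) ord0)].
Proof.
elim: n => [|n [u [un u0 u_ge]]].
  by exists [::]; split => //; rewrite ln1 mulr0 mul0r.
have [k pk k_ge] := pressure_edge_ge K0 p_stoch p_irr (type u) lrA.
exists (rcons u k); rewrite size_rcons un box_size_rcons box_rcons /=.
by split; rewrite ?mulr_gt0 // lnM ?posrE // -natr1; lra.
Qed.

End PressureBounds.

Hypotheses (K2 : (1 < K)%N) (p_irr : irreducible_chain p).

Lemma ln_min_box_size_bounds (s : R) : 0 < s -> exists C : R, forall n,
  - C - decay_rate p * (1 + s) * n%:R <= s * ln (min_box_size n) <=
  C - (decay_rate p * s - ln K%:R) * n%:R.
Proof.
move=> s0; have ns0 : - s < 0 by rewrite oppr_lt0.
have [l [r lrA]] := perron_mx_powR (ltnW K2) p_stoch p_irr (- s).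
pose C : R := \big[Num.max/0]_i `|ln (r i ord0) - ln (r i0 ord0)|.
have C_ge i : `|ln (r i ord0) - ln (r i0 ord0)| <= C.
  exact: (le_bigmax _ (fun i => `|ln (r i ord0) - ln (r i0 ord0)|)).
have pressure_lb := rate_le_pressure K2 p_stoch p_irr ns0.
have pressure_ub := pressure_le_rate K2 p_stoch p_irr ns0.
exists C => n; apply/andP; split.
  have [u [<- u0 <-]] := min_box_size_attained n.
  have := ln_box_size_le (ltnW K2) p_irr lrA u0.
  have : (size u)%:R * pressure p (- s) <=
      (size u)%:R * (decay_rate p * (1 - - s)).
    by rewrite ler_wpM2l.
  by have := C_ge (type u); rewrite ler_norml => /andP[]; lra.
have [u [un u0]] := ln_box_size_ge (ltnW K2) p_irr lrA n.
have : n%:R * (decay_rate p * - - s) <= n%:R * pressure p (- s).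
  by rewrite ler_wpM2l.
have : ln (min_box_size n) <= ln (q u).
  have := min_box_size_le u0; rewrite un.
  have [v [_ v0 <-]] := min_box_size_attained n.
  by rewrite ler_ln.
rewrite -(ler_pM2l s0).
by have := C_ge (type u); rewrite ler_norml => /andP[]; lra.
Qed.

Lemma ln_min_box_size_cvg : aperiodic_chain p ->
  ln (min_box_size n) / n%:R @[n --> \oo] --> - decay_rate p.
Proof.
move=> p_aper; have la0 := decay_rate_gt0 K2 p_stoch p_irr p_aper.
have lnK0 : (0 : R) <= ln K%:R by rewrite ln_ge0 // ler1n ltnW.
apply/cvgrPdist_le => e e0.
have [s s0 se] : exists2 s, 0 < s & s * e = decay_rate p + ln K%:R + 1.
  exists ((decay_rate p + ln K%:R + 1) / e); last by rewrite divfK // gt_eqF.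
  by rewrite divr_gt0 // !ltr_wpDr.
have [C bounds] := ln_min_box_size_bounds s0; near=> n.
have n0 : (0 : R) < n%:R by near: n; exact: nbhs_infty_gtr.
have Cn : C <= n%:R by near: n; exact: nbhs_infty_ger.
have /andP[lower upper] := bounds n.
set x := ln _ in lower upper *.
have -> : - decay_rate p - x / n%:R =
    - (s * x + s * decay_rate p * n%:R) / (s * n%:R).
  by field; rewrite !gt_eqF.
rewrite normf_div normrN [`|s * _|]gtr0_norm ?mulr_gt0 //.
rewrite ler_pdivrMr ?mulr_gt0 // mulrA [e * s]mulrC se ler_norml.
have := mulr_ge0 lnK0 (ltW n0); have := mulr_gt0 la0 n0.
by move=> ? ?; apply/andP; split; lra.
Unshelve. all: by end_near. Qed.

End BoxSizes.

(** * Almost sure convergence *)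

Section AlmostEverywhere.
Context {R : realType} {d : measure_display} {T : measurableType d}.
Variable mu : {measure set T -> \bar R}.

Lemma borel_cantelli (F : (set T)^nat) : (forall n, measurable (F n)) ->
  (\sum_(n <oo) mu (F n) < +oo)%E ->
  {ae mu, forall w, \forall n \near \oo, ~ F n w}.
Proof.
move=> mF sumF; exists (lim_sup_set F); split.
- by apply: bigcapT_measurable => n; apply: bigcup_measurable.
- exact: lim_sup_set_cvg0.
- move=> w /= nearF n _; apply: contrapT => nF; apply: nearF; exists n => //.
  by move=> k /= nk Fk; apply: nF; exists k.
Qed.

Lemma geometric_borel_cantelli (F : (set T)^nat) (C z : R) : 0 <= C ->
  0 < z < 1 -> (forall n, measurable (F n)) ->
  (\forall n \near \oo, mu (F n) <= (C * z ^+ n)%:E)%E ->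
  {ae mu, forall w, \forall n \near \oo, ~ F n w}.
Proof.
move=> C0 /andP[z0 z1] mF [N _ FN].
have : {ae mu, forall w, \forall n \near \oo, ~ F (n + N)%N w}.
  apply: borel_cantelli => //.
  apply: (@le_lt_trans _ _ (C / (1 - z))%:E); last exact: ltry.
  apply: lime_le; first by apply: is_cvg_nneseries => n _ _; exact: measure_ge0.
  apply: nearW => n.
  apply: (@le_trans _ _ (\sum_(0 <= k < n) (C * z ^+ k)%:E)%E).
    apply: lee_sum => k _; apply: le_trans (FN _ (leq_addl _ _)) _.
    rewrite lee_fin exprD mulrA ler_piMr ?mulr_ge0 ?exprn_ge0 ?(ltW z0) //.
    by rewrite exprn_ile1 // ltW.
  rewrite sumEFin lee_fin; apply: le_trans (@geometric_le_lim _ n C z C0 z0 _).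
    by rewrite /series /geometric.
  by rewrite gtr0_norm.
apply: filterS => w [M _ FM]; exists (M + N)%N => // n /= MNn.
have Nn : (N <= n)%N := leq_trans (leq_addl _ _) MNn.
by rewrite -(subnK Nn); apply: FM; rewrite /= leq_subRL // addnC.
Qed.

Lemma measure_bigsetU_card_le (I : finType) (Q : pred I) (F : I -> set T)
    (y : R) :
  (forall i, measurable (F i)) -> (forall i, Q i -> mu (F i) <= y%:E)%E ->
  0 <= y ->
  (mu (\big[setU/set0]_(i | Q i) F i) <= (#|I|%:R * y)%:E)%E.
Proof.
move=> mF Fy y0.
have -> : #|I| = size (index_enum I) by rewrite -sum1_size sum1_card.
elim: (index_enum I) => [|i s ih]; first by rewrite big_nil measure0 mul0r.
rewrite big_cons /= -natr1 mulrDl mul1r; case: ifP => [Qi|_].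
  rewrite addrC EFinD; apply: le_trans (measureU2 _ (mF i) _) _.
    exact: bigsetU_measurable.
  exact: leeD (Fy i Qi) ih.
by apply: le_trans ih _; rewrite lee_fin lerDl.
Qed.

Lemma ae_cvgr (V : normedModType R) (f : nat -> T -> V) (v : V) :
  (forall e, 0 < e ->
    {ae mu, forall w, \forall n \near \oo, `|v - f n w| <= e}) ->
  {ae mu, forall w, f^~ w @ \oo --> v}.
Proof.
move=> f_near.
have : {ae mu, forall w, forall N,
    \forall n \near \oo, `|v - f n w| <= N.+1%:R^-1}.
  by apply/ae_foralln => N; apply: f_near; rewrite invr_gt0.
apply: filterS => w f_w; apply/cvgrPdist_le => e e0.
apply: filterS (f_w (Num.truncn e^-1)) => n /le_trans; apply.
by rewrite invf_ple ?posrE // ltW // truncnS_gt.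
Qed.

End AlmostEverywhere.

Lemma near_linear_le_expR (R : realType) (C d : R) : 0 < d ->
  \forall n \near \oo, C * n%:R <= expR (d * n%:R).
Proof.
move=> d0; near=> n.
have n_ge : 2 * C / d ^+ 2 <= n%:R by near: n; exact: nbhs_infty_ger.
have := @expR_ge1Dxn R (d * n%:R) 1 (mulr_ge0 (ltW d0) (ler0n _ n)).
apply: le_trans; rewrite ler_pdivrMr ?exprn_gt0 // in n_ge.
have := ler_wpM2r (ler0n R n) n_ge.
by rewrite (_ : 2`! = 2%N) // exprMn; lra.
Unshelve. all: by end_near. Qed.

Lemma near_mul_truncn_expR_le (R : realType) (j : nat) (b a : R) :
  0 <= b -> b < a -> \forall n \near \oo,
    (j * (Num.truncn (expR (b * n%:R))).+1)%:R <= expR (a * n%:R).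
Proof.
move=> b0 ba; near=> n; set M := (Num.truncn _).+1.
have n1 : (1 : R) <= n%:R by near: n; exact: nbhs_infty_ger.
have j_le : 2 * j%:R * n%:R <= expR ((a - b) * n%:R).
  by near: n; apply: near_linear_le_expR; rewrite subr_gt0.
have M_le : M%:R <= 2 * expR (b * n%:R).
  rewrite /M -natr1 mulr_natl mulr2n lerD ?truncn_le ?expR_ge0 //.
  by rewrite -expR0 ler_expR mulr_ge0.
rewrite natrM; apply: (le_trans (ler_wpM2l (ler0n R j) M_le)).
have -> : a * n%:R = (a - b) * n%:R + b * n%:R by ring.
rewrite mulrA expRD ler_wpM2r ?expR_ge0 //.
by rewrite (le_trans _ j_le) // mulrC ler_peMr // mulr_ge0.
Unshelve. all: by end_near. Qed.

Lemma near_ln_ge (R : realType) (A : R) : \forall m \near \oo, A <= ln m%:R.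
Proof.
near=> m; have m_ge : expR A <= m%:R by near: m; exact: nbhs_infty_ger.
by rewrite -[leLHS]expRK ler_ln ?posrE ?(lt_le_trans _ m_ge) ?expR_gt0.
Unshelve. all: by end_near. Qed.

Lemma near_truncn_ln (R : realType) (c : R) (Q : nat -> Prop) : 0 < c ->
  (\forall n \near \oo, Q n) ->
  \forall m \near \oo, Q (Num.truncn (c * ln m%:R)).
Proof.
move=> c0 [N _ QN]; near=> m; apply: QN.
have Nm : N%:R <= c * ln m%:R.
  by rewrite -ler_pdivrMl //; near: m; exact: near_ln_ge.
by rewrite /= truncn_ge_nat // (le_trans _ Nm).
Unshelve. all: by end_near. Qed.

(** * Balls *)

Section BallsInBoxes.
Context {R : realType} {K : nat} {d : measure_display} {T : measurableType d}.
Variables (p : 'M[R]_K) (i0 : 'I_K) (P : probability T R).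
Variable X : nat -> nat -> T -> 'I_K.
Hypotheses (p_stoch : stochastic p) (X_balls : balls_process p i0 P X).
Local Notation q := (box_size p i0).
Local Notation deficient := (deficient_generation p i0 X).

Lemma probability_ball_in r u : 0 < q u -> P (ball_in X r u) = (q u)%:E.
Proof.
elim/last_ind: u => [_|u k ih uk0].
  have -> : ball_in X r [::] = setT by apply/seteqP; split.
  exact: probability_setT.
have [u0 _] := box_size_rcons_gt0 p_stoch uk0.
rewrite (balls_fall X_balls) // ih // -EFinM; congr EFin.
by rewrite mulrC divfK // gt_eqF.
Qed.

Lemma measurable_ball_in r u : measurable (ball_in X r u).
Proof. exact: balls_measurable X_balls _ _. Qed.

Definition missed_box (s : seq nat) (u : seq 'I_K) : set T :=
  \bigcap_(r in [set` s]) ~` ball_in X r u.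

Lemma measurable_missed_box s u : measurable (missed_box s u).
Proof.
apply: fin_bigcap_measurable; first exact: finite_seq.
by move=> r _; apply: measurableC; exact: measurable_ball_in.
Qed.

Lemma probability_missed_box s u : uniq s -> 0 < q u ->
  P (missed_box s u) = ((1 - q u) ^+ size s)%:E.
Proof.
move=> us u0; rewrite (balls_indep X_balls) //; last first.
  move=> r _; rewrite /ball_sigma -setTD; apply: sigma_algebraCD.
  by apply: sub_sigma_algebra; exists u.
elim: s {us} => [|r s ih]; first by rewrite big_nil.
rewrite big_cons ih probability_setC; last exact: measurable_ball_in.
by rewrite probability_ball_in // exprS EFinM EFinB.
Qed.

Lemma probability_missed_box_le s u : uniq s -> 0 < q u ->
  (P (missed_box s u) <= (expR (- (q u * (size s)%:R)))%:E)%E.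
Proof.
move=> us u0; rewrite probability_missed_box // lee_fin -mulNr mulrC expRM_natl.
rewrite lerXn2r ?nnegrE ?expR_ge0 ?subr_ge0 ?expR_ge1Dx //.
exact: box_size_le1.
Qed.

Lemma nb_balls_ge (j M m : nat) u w : (j * M <= m)%N ->
  (forall g, (g < j)%N -> ~ missed_box (iota (g * M) M) u w) ->
  (j <= nb_balls X m u w)%N.
Proof.
move=> jMm hit.
have /choice[f fP] (g : 'I_j) : exists r : 'I_m,
    (r : nat) \in iota (g * M) M /\ ball_in X r u w.
  apply: contrapT => no_ball; apply: (hit g (ltn_ord g)) => r /= rg rw.
  have rm : (r < m)%N.
    apply: leq_trans jMm; move: rg; rewrite mem_iota => /andP[_ rg].
    by apply: leq_trans rg _; rewrite -mulSnr leq_mul2r ltn_ord orbT.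
  by apply: no_ball; exists (Ordinal rm).
have fE g : (f g %/ M)%N = g.
  have [+ _] := fP g; rewrite mem_iota => /andP[gM fM].
  have M0 : (0 < M)%N by rewrite -(ltn_add2l (g * M)) addn0 (leq_ltn_trans gM).
  by rewrite -(subnKC gM) divnMDl // divn_small ?addn0 // ltn_subLR.
have f_inj : injective f.
  by move=> g g' fgg'; apply: val_inj; rewrite /= -(fE g) -(fE g') fgg'.
rewrite /nb_balls -{1}(card_ord j) -(card_codom f_inj); apply: subset_leq_card.
by apply/fintype.subsetP => r /codomP[g ->]; rewrite inE; have [_ /eqP] := fP g.
Qed.

Lemma deficient_generation_mono m j w n n' : (n <= n')%N ->
  deficient m j w n -> deficient m j w n'.
Proof.
move=> /subnKC <-; elim: (n' - n)%N => [|k ih]; first by rewrite addn0.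
move=> /ih[u [un u0 uj]]; have [i ui0] := box_size_gt0_next p_stoch u0.
exists (rcons u i); split => //; first by rewrite size_rcons un addnS.
apply: leq_ltn_trans uj; apply: subset_leq_card; apply/fintype.subsetP => r.
rewrite !inE size_rcons /ball_box mkseqS => /eqP /rcons_inj[<- _].
by rewrite size_mkseq.
Qed.

Lemma first_deficientP m j w n : deficient m j w n ->
  deficient m j w (first_deficient p i0 X m j w) /\
  (first_deficient p i0 X m j w <= n)%N.
Proof.
move=> dn; rewrite /first_deficient; case: xgetP => [g _ [dg g_min]|none].
  by split => //; exact: g_min.
have ex_deficient : exists k, `[< deficient m j w k >].
  by exists n; exact/asboolP.
case: (ex_minnP ex_deficient) => g /asboolP dg g_min.
case: (none g); split => // k dk; exact/g_min/asboolP.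
Qed.

Lemma first_deficient_gt m j w n n' : ~ deficient m j w n ->
  deficient m j w n' -> (n < first_deficient p i0 X m j w)%N.
Proof.
move=> ndn /first_deficientP[dG _]; rewrite ltnNge; apply/negP => Gn.
exact/ndn/(deficient_generation_mono Gn dG).
Qed.

Variables (la : R) (j : nat).
Hypotheses (la0 : 0 < la) (j0 : (0 < j)%N).
Hypothesis min_box_cvg :
  ln (min_box_size p i0 n) / n%:R @[n --> \oo] --> - la.

Lemma near_box_size_ge c : la < c -> \forall n \near \oo, forall u,
  size u = n -> 0 < q u -> expR (- (c * n%:R)) <= q u.
Proof.
move=> lac; near=> n => u un u0.
have n0 : (0 : R) < n%:R by near: n; exact: nbhs_infty_gtr.
have : - c < ln (min_box_size p i0 n) / n%:R.
  by near: n; apply: (cvgr_gt (- la)) => //; rewrite ltrN2.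
rewrite ltr_pdivlMr // mulNr => /ltW c_le.
have [v [_ v0 min_v]] := min_box_size_attained i0 p_stoch n.
apply: le_trans (min_box_size_le u0); rewrite un -min_v -[leRHS]lnK ?posrE //.
by rewrite ler_expR min_v.
Unshelve. all: by end_near. Qed.

Lemma near_box_size_le c : c < la -> \forall n \near \oo,
  min_box_size p i0 n <= expR (- (c * n%:R)).
Proof.
move=> cla; near=> n.
have n0 : (0 : R) < n%:R by near: n; exact: nbhs_infty_gtr.
have : ln (min_box_size p i0 n) / n%:R < - c.
  by near: n; apply: (cvgr_lt (- la)) => //; rewrite ltrN2.
rewrite ltr_pdivrMr // mulNr => /ltW.
have [v [_ v0 <-]] := min_box_size_attained i0 p_stoch n.
by rewrite -[X in _ -> X <= _]lnK ?posrE // ler_expR.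
Unshelve. all: by end_near. Qed.

Lemma ae_deficient b : b < la -> {ae P, forall w, \forall n \near \oo,
  forall m, m%:R <= expR (b * n%:R) -> deficient m j w n}.
Proof.
move=> bla; pose c := (b + la) / 2.
have /choice[u uP] n := min_box_size_attained i0 p_stoch n.
pose M n := Num.truncn (expR (b * n%:R)).
pose F n := \big[setU/set0]_(r < M n) ball_in X r (u n).
have F_le n : (P (F n) <= ((M n)%:R * q (u n))%:E)%E.
  have [_ u0 _] := uP n; rewrite -[X in (X%:R * _)%:E]card_ord.
  apply: measure_bigsetU_card_le => [r|r _|]; last exact: ltW.
    exact: measurable_ball_in.
  by rewrite -(probability_ball_in r u0).
have : {ae P, forall w, \forall n \near \oo, ~ F n w}.
  apply: (@geometric_borel_cantelli _ _ _ P F 1 (expR (b - c))) => //.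
  - by rewrite expR_gt0 expR_lt1 /c; lra.
  - by move=> n; apply: bigsetU_measurable => r _; exact: measurable_ball_in.
  have cla : c < la by rewrite /c; lra.
  near=> n; apply: le_trans (F_le n) _.
  rewrite mul1r lee_fin -expRM_natr mulrBl expRD; apply: ler_pM => //.
  - exact: box_size_ge0.
  - by rewrite truncn_le ?expR_ge0.
  have [_ _ ->] := uP n; near: n; exact: near_box_size_le.
apply: filterS => w; apply: filterS => n nFn m mb.
have [un u0 _] := uP n; exists (u n); split => //.
rewrite /nb_balls eq_card0 // => r; rewrite !inE; apply/negP => /eqP ur.
have rM : (r < M n)%N.
  by apply: leq_trans (ltn_ord r) _; rewrite /M truncn_ge_nat ?expR_ge0.
by apply: nFn; rewrite /F (bigD1 (Ordinal rM)) //=; left.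
Unshelve. all: by end_near. Qed.

(* If a box holds fewer than [j] of the first [j * M] balls, then it is missed
   by one of their [j] blocks of [M] consecutive balls. *)
Definition missed_block n M : set T :=
  \big[setU/set0]_(gu : 'I_j * n.-tuple 'I_K | 0 < q gu.2)
    missed_box (iota (gu.1 * M) M) gu.2.

Lemma measurable_missed_block n M : measurable (missed_block n M).
Proof.
by apply: bigsetU_measurable => gu _; exact: measurable_missed_box.
Qed.

Lemma deficient_missed_block m n M w : (j * M <= m)%N -> deficient m j w n ->
  missed_block n M w.
Proof.
move=> jMm [u [un u0]]; rewrite ltnNge => /negP uj; apply: contrapT => nmiss.
apply: uj; apply: nb_balls_ge jMm _ => g gj miss; apply: nmiss.
have {}un : size u == n by apply/eqP.
by rewrite /missed_block (bigD1 (Ordinal gj, Tuple un)) //=; left.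
Qed.

Lemma probability_missed_block_le n M y : 0 <= y ->
  (forall u, size u = n -> 0 < q u -> expR (- (q u * M%:R)) <= y) ->
  (P (missed_block n M) <= (j%:R * K%:R ^+ n * y)%:E)%E.
Proof.
move=> y0 miss_le; rewrite -natrX -natrM.
have -> : (j * K ^ n)%N = #|{: 'I_j * n.-tuple 'I_K}|.
  by rewrite card_prod card_tuple !card_ord.
apply: measure_bigsetU_card_le => // [gu|gu u0].
  exact: measurable_missed_box.
apply: le_trans (probability_missed_box_le (iota_uniq _ _) u0) _.
by rewrite lee_fin size_iota miss_le ?size_tuple.
Qed.

Lemma ae_no_missed_block b : la < b -> {ae P, forall w, \forall n \near \oo,
  ~ missed_block n (Num.truncn (expR (b * n%:R))).+1 w}.
Proof.
move=> lab; pose c := (la + b) / 2.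
have [lac cb] : la < c /\ c < b by rewrite /c; split; lra.
pose M n := (Num.truncn (expR (b * n%:R))).+1.
apply: (@geometric_borel_cantelli _ _ _ P (fun n => missed_block n (M n)) j%:R
  (expR (- 1))) => //.
- by rewrite expR_gt0 expR_lt1 ltrN10.
- by move=> n; exact: measurable_missed_block.
have K0 : (0 < K)%N := leq_ltn_trans (leq0n _) (ltn_ord i0).
near=> n; pose y : R := expR (- ((ln K%:R + 1) * n%:R)).
apply: (@le_trans _ _ (j%:R * K%:R ^+ n * y)%:E).
  apply: probability_missed_block_le => [|u un u0]; first exact: expR_ge0.
  rewrite ler_expR lerN2; apply: (@le_trans _ _ (expR ((b - c) * n%:R))).
    by near: n; apply: near_linear_le_expR; rewrite subr_gt0.
  rewrite mulrBl addrC expRD; apply: ler_pM; rewrite ?expR_ge0 //.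
    by move: u un u0; near: n; exact: near_box_size_ge.
  by rewrite ltW // truncnS_gt.
rewrite lee_fin -mulrA ler_wpM2l // -{1}(@lnK _ K%:R) ?posrE ?ltr0n //.
by rewrite -!expRM_natr -expRD ler_expR; lra.
Unshelve. all: by end_near. Qed.

Lemma ae_not_deficient a : la < a -> {ae P, forall w, \forall n \near \oo,
  forall m, expR (a * n%:R) <= m%:R -> ~ deficient m j w n}.
Proof.
move=> laa; pose b := (la + a) / 2.
have [lab ba] : la < b /\ b < a by rewrite /b; split; lra.
have b0 : 0 <= b by rewrite ltW // (lt_trans la0).
apply: filterS (ae_no_missed_block lab) => w.
apply: filterS2 (near_mul_truncn_expR_le j b0 ba) => n jM not_missed m am.
apply: contra_not not_missed; apply: deficient_missed_block.
by rewrite -(ler_nat R) (le_trans jM).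
Qed.

Lemma ae_exists_deficient :
  {ae P, forall w, forall m, exists n, deficient m j w n}.
Proof.
have la2 : la / 2 < la by rewrite ltr_pdivrMr // ltr_pMr // ltr1n.
apply: filterS (ae_deficient la2) => w deficient_w m.
have m_le : \forall n \near \oo, m%:R <= expR (la / 2 * n%:R).
  near=> n; have n1 : (1 : R) <= n%:R by near: n; exact: nbhs_infty_ger.
  apply: (@le_trans _ _ (m%:R * n%:R)); first by rewrite ler_peMr.
  by near: n; apply: near_linear_le_expR; rewrite divr_gt0.
have [n [n_deficient m_n]] := filter_ex (filterI deficient_w m_le).
by exists n; exact: n_deficient.
Unshelve. all: by end_near. Qed.

Lemma ae_first_deficient_ge c : 0 < c < la^-1 ->
  {ae P, forall w, \forall m \near \oo,
    c * ln m%:R <= (first_deficient p i0 X m j w)%:R}.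
Proof.
move=> /andP[c0 cla].
have la_c : la < c^-1 by rewrite -ltf_pV2 ?posrE ?invr_gt0 ?invrK.
apply: filterS2 (ae_not_deficient la_c) ae_exists_deficient => w.
move=> /(near_truncn_ln c0) + exists_deficient.
apply: filterS2 (near_ln_ge (1 : R)) => m ln_m1.
have cln0 : 0 <= c * ln m%:R.
  by rewrite mulr_ge0 ?(ltW c0) // (le_trans ler01 ln_m1).
move=> /(_ m); set n := Num.truncn _ => not_deficient.
have ndn : ~ deficient m j w n.
  have m0 : (0 : R) < m%:R.
    by rewrite ltr0n lt0n; apply: contraTneq ln_m1 => ->; rewrite ln0 // ler10.
  apply: not_deficient; rewrite -[leRHS]lnK ?posrE // ler_expR.
  by rewrite ler_pdivrMl // truncn_le.
have [n' dn'] := exists_deficient m.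
apply: le_trans (ltW (truncnS_gt _)) _; rewrite ler_nat.
exact: first_deficient_gt ndn dn'.
Qed.

Lemma ae_first_deficient_le c : la^-1 < c ->
  {ae P, forall w, \forall m \near \oo,
    (first_deficient p i0 X m j w)%:R <= c * ln m%:R}.
Proof.
move=> lac; have c0 : 0 < c by rewrite (lt_trans _ lac) // invr_gt0.
have c_la : c^-1 < la by rewrite -ltf_pV2 ?posrE ?invr_gt0 ?invrK.
pose b := (c^-1 + la) / 2.
have cb : c^-1 < b by rewrite /b; lra.
have b0 : 0 < b by rewrite (lt_trans _ cb) // invr_gt0.
have bla : b < la by rewrite /b; lra.
have bc1 : 0 < b * c - 1 by rewrite subr_gt0 -ltr_pdivrMr // div1r.
apply: filterS (ae_deficient bla) => w /(near_truncn_ln c0).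
apply: filterS2 (near_ln_ge (b / (b * c - 1))) => m.
rewrite ler_pdivrMr // => ln_m_ge /(_ m); set n := Num.truncn _ => deficient_n.
have ln_m0 : (0 : R) <= ln m%:R.
  by rewrite -(pmulr_lge0 _ bc1) (le_trans (ltW b0)).
have cln0 : 0 <= c * ln m%:R by rewrite mulr_ge0 // ltW.
have dn : deficient m j w n.
  apply: deficient_n; have [->|m0] := posnP m; first exact: expR_ge0.
  rewrite -[leLHS]lnK ?posrE ?ltr0n // ler_expR.
  have := ler_wpM2l (ltW b0) (ltW (truncnS_gt (c * ln m%:R))).
  by rewrite -/n -natr1; lra.
have [_ Gn] := first_deficientP dn.
by apply: le_trans (_ : n%:R <= _); rewrite ?ler_nat // truncn_le.
Qed.

Lemma first_deficient_cvg : {ae P, forall w,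
  (fun m : nat => (ln m%:R)^-1 * (first_deficient p i0 X m j w)%:R) @ \oo -->
    la^-1}.
Proof.
apply: ae_cvgr => e e0; have v0 : 0 < la^-1 by rewrite invr_gt0.
have [e' [e'0 e'e e'v]] : exists e', [/\ 0 < e', e' <= e & e' < la^-1].
  exists (Num.min e (la^-1 / 2)); split.
  - by rewrite lt_min e0 divr_gt0.
  - by rewrite ge_min lexx.
  - by rewrite gt_min ltr_pdivrMr // ltr_pMr // ltr1n orbT.
have lower : 0 < la^-1 - e' < la^-1 by rewrite subr_gt0 e'v gtrBl.
have upper : la^-1 < la^-1 + e' by rewrite ltrDl.
have := ae_first_deficient_le upper; have := ae_first_deficient_ge lower.
apply: filterS2 => w.
apply: filterS3 (near_ln_ge (1 : R)) => m ln_m1 G_ge G_le.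
have ln_m0 : (0 : R) < ln m%:R by rewrite (lt_le_trans ltr01 ln_m1).
apply: le_trans e'e; rewrite ler_distlC mulrC ler_pdivlMr // ler_pdivrMr //.
by rewrite G_ge G_le.
Qed.

End BallsInBoxes.

Theorem theorem3 (R : realType) (K : nat) (hK : (2 <= K)%N) (p : 'M[R]_K)
  (p_stoch : stochastic p) (p_irr : irreducible_chain p)
  (p_aper : aperiodic_chain p)
  (d : measure_display) (T : measurableType d) (P : probability T R)
  (X : nat -> nat -> T -> 'I_K)
  (hX : balls_process p (Ordinal (ltnW hK)) P X)
  (j : nat) (hj : (1 <= j)%N) :
  cvg (Cstar_ratio p theta @[theta --> -oo]) /\
  {ae P, forall w : T,
    (fun m : nat =>
       (ln m%:R)^-1 * (first_deficient p (Ordinal (ltnW hK)) X m j w)%:R)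
      @ \oo --> Cstar p}.
Proof.
have ratio_cvg := Cstar_ratio_cvg hK p_stoch p_irr p_aper.
have -> : Cstar p = (decay_rate p)^-1 by exact: cvg_lim ratio_cvg.
split; first exact: cvgP ratio_cvg.
apply: (first_deficient_cvg p_stoch hX) => //; first exact: decay_rate_gt0.
exact: ln_min_box_size_cvg.
Qed.
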